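(* Let $\mathcal{X}$ be a compact separable metric space. For $\mu=(\mathsf{G},\mathsf{q},\mathsf{R})\in\mathcal{M}(\mathcal{X},\mathbb{X})$ with $\mathcal{J}_{\Lambda,\mathcal{X}}(\mu)<+\infty$, it holds that for every Borel set $E\subset\mathcal{X}$, $$|\mathsf{q}|(E)\le\sqrt{\mathrm{Tr}\,\mathsf{G}(E)}\,\|\Lambda_1\|_{\mathrm F}\,\|G^\dagger q\Lambda_1^\dagger\|_{L^2_{\mathsf{G}}(E)},\qquad|\mathsf{R}|(E)\le\sqrt{\mathrm{Tr}\,\mathsf{G}(E)}\,\|\Lambda_2\|_{\mathrm F}\,\|G^\dagger R\Lambda_2^{-1}\|_{L^2_{\mathsf{G}}(E)}.$$
   Context: $\mathbb{S}^n,\mathbb{S}^n_+,\mathbb{S}^n_{++}$ are the real symmetric, positive semidefinite, positive definite $n\times n$ matrices; $\mathbb{M}^n=\mathbb{R}^{n\times n}$; $A\cdot B=\mathrm{Tr}(A^{\mathrm T}B)$, $\|A\|_{\mathrm F}=\sqrt{A\cdot A}$; $A^\dagger$ is the pseudoinverse; $\mathrm{Ran}$ is the range. $\mathcal{M}(\mathcal{X},V)$ denotes finite $V$-valued Radon measures; $|\mathsf{q}|$ is the total variation measure (with respect to the Frobenius norm). Fix positive integers $n,k$ and $\Lambda=(\Lambda_1,\Lambda_2)$ with $\Lambda_1\in\mathbb{S}^k_+$, $\Lambda_2\in\mathbb{S}^n_{++}$. Put $\mathbb{X}=\mathbb{S}^n\times\mathbb{R}^{n\times k}\times\mathbb{M}^n$.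 Define $J_\Lambda(X,Y,Z)=\frac12(Y\Lambda_1^\dagger)\cdot(X^\dagger Y\Lambda_1^\dagger)+\frac12(Z\Lambda_2^{-1})\cdot(X^\dagger Z\Lambda_2^{-1})$ if $X\in\mathbb{S}^n_+$, $\mathrm{Ran}(Y^{\mathrm T})\subset\mathrm{Ran}(\Lambda_1)$ and $\mathrm{Ran}([Y,Z])\subset\mathrm{Ran}(X)$, and $+\infty$ otherwise. For $\mu\in\mathcal{M}(\mathcal{X},\mathbb{X})$, $\mathcal{J}_{\Lambda,\mathcal{X}}(\mu)=\int_{\mathcal{X}}J_\Lambda(\frac{\mathrm{d}\mu}{\mathrm{d}\lambda})\,\mathrm{d}\lambda$ for any nonnegative finite Radon $\lambda$ with $|\mu|\ll\lambda$ (independent of $\lambda$). If $\mathcal{J}_{\Lambda,\mathcal{X}}(\mu)<\infty$, then $\mathsf{G}$ is $\mathbb{S}^n_+$-valued; $G,q,R$ denote the densities of $\mathsf{G},\mathsf{q},\mathsf{R}$ with respect to such a $\lambda$, and the functions $G^\dagger q\Lambda_1^\dagger$ and $G^\dagger R\Lambda_2^{-1}$ do not depend on $\lambda$. $\|P\|^2_{L^2_{\mathsf{G}}(E)}=\int_EP\cdot(G_\lambda P)\,\mathrm{d}\lambda$. *)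

(* Defs.v *)
From HB Require Import structures.
From mathcomp Require Import all_boot all_order all_algebra.
From mathcomp Require Import all_classical all_reals all_analysis.

Set Implicit Arguments.
Unset Strict Implicit.
Unset Printing Implicit Defensive.

Import Order.TTheory GRing.Theory Num.Theory.
Import numFieldNormedType.Exports.

Local Open Scope classical_set_scope.
Local Open Scope ring_scope.

(* [measurableType]s are pointed, hence so are the metric spaces used here. *)
#[short(type="pmetricType")]
HB.structure Definition PMetric (R : numDomainType) :=
  {T of Metric R T & Pointed T}.

Definition separable (X : topologicalType) :=
  exists2 S : set X, countable S & dense S.

Definition borel (X : ptopologicalType) := g_sigma_algebraType (@open X).

Section matrices.
Context {R : realType}.

Definition frob m p (A B : 'M[R]_(m, p)) : R := \tr (A^T *m B).

Definition fnorm m p (A : 'M[R]_(m, p)) : R := Num.sqrt (frob A A).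

Definition symmx n : set 'M[R]_n := [set A | A^T = A].

Definition psdmx n : set 'M[R]_n :=
  [set A | symmx A /\ forall v : 'cV[R]_n, 0 <= (v^T *m A *m v) 0 0].

Definition pdmx n : set 'M[R]_n :=
  [set A | symmx A /\
           forall v : 'cV[R]_n, v != 0 -> 0 < (v^T *m A *m v) 0 0].

(* Ran A `<=` Ran B for column spaces; [<=%MS] compares row spaces. *)
Definition ran_sub m p q (A : 'M[R]_(m, p)) (B : 'M[R]_(m, q)) : bool :=
  (A^T <= B^T)%MS.

Definition penrose m p (A : 'M[R]_(m, p)) : set 'M[R]_(p, m) :=
  [set B | [/\ A *m B *m A = A, B *m A *m B = B,
               (A *m B)^T = A *m B & (B *m A)^T = B *m A]].

Definition pinverse m p (A : 'M[R]_(m, p)) : 'M[R]_(p, m) := xget 0 (penrose A).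

Lemma row_free_gram_unit m p (F : 'M[R]_(m, p)) :
  row_free F -> F *m F^T \in unitmx.
Proof.
move=> Ffree; rewrite -row_free_unit -kermx_eq0; apply/rowV0P => v.
move=> /sub_kermxP vFF; apply: (row_free_inj Ffree); rewrite mul0mx.
have : (v *m F) *m (v *m F)^T = 0.
  by rewrite trmx_mul mulmxA -(mulmxA v) vFF mul0mx.
move=> /matrixP/(_ 0 0); rewrite [LHS]mxE [RHS]mxE => /eqP.
rewrite psumr_eq0 => [/allP vF0|i _]; last first.
  by rewrite [X in _ * X]mxE -expr2 sqr_ge0.
apply/rowP => j; have := vF0 j; rewrite mem_index_enum => /(_ isT) /=.
by rewrite [X in _ * X]mxE -expr2 sqrf_eq0 [RHS]mxE => /eqP.
Qed.

Lemma pinverseP m p (A : 'M[R]_(m, p)) : penrose A (pinverse A).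
Proof.
suff [B AB] : penrose A !=set0 by exact: (xgetI 0 AB).
have [s [C [F [AE Ffree Cfree]]]] : exists s (C : 'M[R]_(m, s))
    (F : 'M[R]_(s, p)), [/\ A = C *m F, row_free F & row_free C^T].
  exists (\rank A), (col_base A), (row_base A); rewrite mulmx_base.
  by rewrite row_base_free /row_free mxrank_tr; split => //; exact: col_base_full.
have FU := row_free_gram_unit Ffree.
have CU := row_free_gram_unit Cfree; rewrite trmxK in CU.
set f := F *m F^T in FU; set c := C^T *m C in CU.
have fs : (invmx f)^T = invmx f by rewrite trmx_inv trmx_mul trmxK.
have cs : (invmx c)^T = invmx c by rewrite trmx_inv trmx_mul trmxK.
exists (F^T *m invmx f *m (invmx c *m C^T)).
have AB : A *m (F^T *m invmx f *m (invmx c *m C^T)) = C *m invmx c *m C^T.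
  rewrite AE !mulmxA -(mulmxA C F) -/f -(mulmxA C f) mulmxV// mulmx1.
  by rewrite -!mulmxA.
have BA : (F^T *m invmx f *m (invmx c *m C^T)) *m A = F^T *m invmx f *m F.
  by rewrite AE -!mulmxA (mulmxA C^T) -/c (mulmxA (invmx c)) mulVmx// mul1mx.
split.
- rewrite AB AE -!mulmxA (mulmxA C^T) -/c (mulmxA (invmx c)).
  by rewrite mulVmx// mul1mx.
- rewrite BA -!mulmxA (mulmxA F) -/f (mulmxA f).
  by rewrite mulmxV// mul1mx.
- by rewrite AB !trmx_mul trmxK cs mulmxA.
- by rewrite BA !trmx_mul trmxK fs mulmxA.
Qed.

Lemma penrose_uniq m p (A : 'M[R]_(m, p)) (B B' : 'M[R]_(p, m)) :
  penrose A B -> penrose A B' -> B = B'.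
Proof.
move=> [ABA BAB ABs BAs] [AB'A B'AB' AB's B'As].
have AE : A *m B = A *m B'.
  have -> : A *m B = (A *m B') *m (A *m B) by rewrite !mulmxA AB'A.
  by rewrite -AB's -ABs -trmx_mul mulmxA ABA.
have EA : B *m A = B' *m A.
  have -> : B *m A = (B *m A) *m (B' *m A) by rewrite -mulmxA (mulmxA A) AB'A.
  by rewrite -BAs -B'As -trmx_mul -mulmxA (mulmxA A) ABA.
by rewrite -BAB -mulmxA AE mulmxA EA B'AB'.
Qed.

Definition Jfun n k (L1 : 'M[R]_k) (L2 : 'M[R]_n)
    (X : 'M[R]_n) (Y : 'M[R]_(n, k)) (Z : 'M[R]_n) : \bar R :=
  if `[< [/\ psdmx X, ran_sub Y^T L1 & ran_sub (row_mx Y Z) X] >] then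
    (2^-1 * frob (Y *m pinverse L1) (pinverse X *m Y *m pinverse L1)
     + 2^-1 * frob (Z *m invmx L2) (pinverse X *m Z *m invmx L2))%:E
  else +oo%E.

End matrices.

Section total_variation.
Context d (T : measurableType d) {R : realType}.
Local Open Scope ereal_scope.

(* Total variation of a vector measure; [N A] is the norm of its value at A. *)
Definition total_variation (N : set T -> R) (E : set T) : \bar R :=
  ereal_sup [set s | exists F : (set T)^nat,
    [/\ forall i, measurable (F i), trivIset setT F, \bigcup_i F i = E &
        s = \sum_(0 <= i <oo) (N (F i))%:E]].

End total_variation.

Section matrix_measures.
Context d (T : measurableType d) {R : realType}.

(* Matrix-valued finite measures, given by their entries. On the Borel sets of
   a compact metric space every finite measure is Radon. *)
Definition mxmeasure m p := 'I_m -> 'I_p -> {charge set T -> \bar R}.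

Definition mxval m p (nu : mxmeasure m p) (A : set T) : 'M[R]_(m, p) :=
  \matrix_(i, j) fine (nu i j A).

Definition mxtv m p (nu : mxmeasure m p) : set T -> \bar R :=
  total_variation (fun A => fnorm (mxval nu A)).

Definition mxdensity m p (nu : mxmeasure m p)
    (lam : {finite_measure set T -> \bar R}) (x : T) : 'M[R]_(m, p) :=
  \matrix_(i, j) fine (Radon_Nikodym (nu i j) lam x).

Section triple.
Context n k (G : mxmeasure n n) (q : mxmeasure n k) (r : mxmeasure n n).

(* |mu| for mu = (G, q, r), with the Euclidean product of Frobenius norms *)
Definition Xtv : set T -> \bar R :=
  total_variation (fun A =>
    Num.sqrt (fnorm (mxval G A) ^+ 2 + fnorm (mxval q A) ^+ 2
              + fnorm (mxval r A) ^+ 2)).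

(* The reference measure is a parameter; the value does not depend on it
   among those dominating |mu|. *)
Definition Jint (L1 : 'M[R]_k) (L2 : 'M[R]_n)
    (lam : {finite_measure set T -> \bar R}) : \bar R :=
  (\int[lam]_x Jfun L1 L2
     (mxdensity G lam x) (mxdensity q lam x) (mxdensity r lam x))%E.

End triple.

Definition L2norm n p (G : mxmeasure n n)
    (lam : {finite_measure set T -> \bar R}) (E : set T)
    (P : T -> 'M[R]_(n, p)) : \bar R :=
  sqrte (\int[lam]_(x in E) (frob (P x) (mxdensity G lam x *m P x))%:E)%E.

End matrix_measures.

(* Main.v *)
(**
Where [J] is finite, [q = G G^+ q] and [q = q L1^+ L1], so [q = G P L1] with
[P = G^+ q L1^+].  Cauchy-Schwarz for the form [G] gives
[|G P|^2 <= tr G * (P . G P)], hence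
[|q| <= |L1| * sqrt (tr G) * sqrt (P . G P)] pointwise; integrating over [E] and
applying the integral Cauchy-Schwarz inequality bounds [|q|(E)], because the
total variation is at most the integral of the norm of the density.  The same
works for [r] with [L2] in place of [L1].

Finiteness of the integral of [J] gives the domain conditions only almost
everywhere for [lam0].  These conditions are invariant under scaling the three
densities by a common nonnegative factor, and by the chain rule through
[lam0 + lam] the densities for [lam] are such multiples of those for [lam0],
where a zero factor makes the conditions trivial.
*)
From HB Require Import structures.
Require Import Defs.
From mathcomp Require Import all_boot all_order all_algebra.
From mathcomp Require Import all_classical all_reals all_analysis.
From mathcomp Require Import measurable_realfun ring lra.

Import Order.TTheory GRing.Theory Num.Theory.
Import numFieldNormedType.Exports.

Local Open Scope classical_set_scope.
Local Open Scope ring_scope.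

(** * The Frobenius inner product and semidefinite forms *)

Section frobenius.
Set Implicit Arguments.
Unset Strict Implicit.
Context {R : realType}.

Lemma frobE m p (A B : 'M[R]_(m, p)) :
  frob A B = \sum_j \sum_i A i j * B i j.
Proof.
by apply: eq_bigr => j _; rewrite mxE; apply: eq_bigr => i _; rewrite mxE.
Qed.

Lemma frob_col m p (A B : 'M[R]_(m, p)) :
  frob A B = \sum_j ((col j A)^T *m col j B) 0 0.
Proof.
rewrite frobE; apply: eq_bigr => j _; rewrite mxE.
by apply: eq_bigr => i _; rewrite !mxE.
Qed.

Lemma col_mulmx m n p (A : 'M[R]_(m, n)) (B : 'M[R]_(n, p)) j :
  col j (A *m B) = A *m col j B.
Proof. by rewrite !colE mulmxA. Qed.

Lemma frobC m p (A B : 'M[R]_(m, p)) : frob A B = frob B A.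
Proof. by rewrite /frob -mxtrace_tr trmx_mul trmxK. Qed.

Lemma frob_tr m p (A B : 'M[R]_(m, p)) : frob A^T B^T = frob A B.
Proof. by rewrite /frob trmxK mxtrace_mulC -/(frob B A) frobC. Qed.

Lemma frob_ge0 m p (A : 'M[R]_(m, p)) : 0 <= frob A A.
Proof.
rewrite frobE; apply: sumr_ge0 => j _; apply: sumr_ge0 => i _.
by rewrite -expr2 sqr_ge0.
Qed.

Lemma fnorm_ge0 m p (A : 'M[R]_(m, p)) : 0 <= fnorm A.
Proof. exact: sqrtr_ge0. Qed.

Lemma sqr_fnorm m p (A : 'M[R]_(m, p)) : fnorm A ^+ 2 = frob A A.
Proof. by rewrite sqr_sqrtr// frob_ge0. Qed.

Lemma psdmx0 n : psdmx (0 : 'M[R]_n).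
Proof.
split; first exact: trmx0.
by move=> v; rewrite mulmx0 mul0mx mxE.
Qed.

Lemma psdmx1 n : psdmx (1%:M : 'M[R]_n).
Proof.
split; first exact: trmx1.
move=> v; rewrite mulmx1 mxE; apply: sumr_ge0 => i _.
by rewrite mxE -expr2 sqr_ge0.
Qed.

Lemma psdmxZ n (c : R) (A : 'M[R]_n) : 0 <= c -> psdmx A -> psdmx (c *: A).
Proof.
move=> c0 [As Av]; split; first by rewrite /symmx/= linearZ/= As.
by move=> v; rewrite -scalemxAr -scalemxAl mxE mulr_ge0.
Qed.

Lemma psdmx_conj n p (A : 'M[R]_n) (B : 'M[R]_(n, p)) :
  psdmx A -> psdmx (B^T *m A *m B).
Proof.
move=> [As Av]; split; first by rewrite /symmx/= !trmx_mul trmxK As mulmxA.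
by move=> v; have := Av (B *m v); rewrite trmx_mul !mulmxA.
Qed.

Lemma psdmx_gram m p (A : 'M[R]_(m, p)) : psdmx (A^T *m A).
Proof. by have := psdmx_conj A (psdmx1 m); rewrite mulmx1. Qed.

(** The form at [u + t *: v] is the polynomial [a + 2 t b + t^2 c], nonnegative for every [t]; a
    suitable [t] gives the bound. As [A] is only semidefinite, [c = 0] is a separate case. *)
Lemma psdmx_CauchySchwarz n (A : 'M[R]_n) (u v : 'cV[R]_n) : psdmx A ->
  (u^T *m A *m v) 0 0 ^+ 2 <= (u^T *m A *m u) 0 0 * (v^T *m A *m v) 0 0.
Proof.
move=> [As Av]; set a := (u^T *m A *m u) 0 0.
set b := (u^T *m A *m v) 0 0; set c := (v^T *m A *m v) 0 0.
have bE : (v^T *m A *m u) 0 0 = b.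
  by rewrite -[in LHS](trmxK (_ *m _)) mxE !trmx_mul trmxK As mulmxA.
have abc t : 0 <= a + 2 * t * b + t ^+ 2 * c.
  suff -> : a + 2 * t * b + t ^+ 2 * c =
      ((u + t *: v)^T *m A *m (u + t *: v)) 0 0 by exact: Av.
  have -> : (u + t *: v)^T = u^T + t *: v^T by rewrite linearD/= linearZ.
  rewrite !(mulmxDl, mulmxDr) -!(scalemxAl, scalemxAr).
  move: bE; rewrite /a /b /c; move: (u^T *m A *m u) (u^T *m A *m v).
  move: (v^T *m A *m u) (v^T *m A *m v) => M1 M2 M3 M4.
  by rewrite !mxE => ->; ring.
have a0 : 0 <= a := Av u.
have c0 : 0 <= c := Av v.
have [cE|cn0] := eqVneq c 0.
  have [->|bn0] := eqVneq b 0; first by rewrite expr0n mulr_ge0.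
  (* With [c = 0] the polynomial is affine, and at this [t] it equals [-1], so [b != 0] is
     absurd. *)
  have := abc (- (a + 1) / (2 * b)); rewrite cE mulr0 addr0.
  have -> : 2 * (- (a + 1) / (2 * b)) * b = - (a + 1) by field.
  by lra.
(* The minimiser of the polynomial. *)
have := abc (- b / c).
have -> : a + 2 * (- b / c) * b + (- b / c) ^+ 2 * c = (a * c - b ^+ 2) / c.
  by field.
have cpos : 0 < c by rewrite lt0r cn0.
by rewrite pmulr_lge0 ?invr_gt0// subr_ge0.
Qed.

(** Each entry of [A *m B] pairs a row of [A] with a column of [B]; Cauchy-Schwarz for the identity
    form bounds its square, and the bounds sum to a product. *)
Lemma ler_sqr_mulmx m n p (A : 'M[R]_(m, n)) (B : 'M[R]_(n, p)) :
  frob (A *m B) (A *m B) <= frob A A * frob B B.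
Proof.
have fA : frob A A = \sum_i (row i A *m (row i A)^T) 0 0.
  rewrite -frob_tr frob_col; apply: eq_bigr => i _.
  by rewrite -tr_row trmxK.
rewrite fA frob_col [in leRHS]frob_col mulr_sumr; apply: ler_sum => j _.
rewrite mulr_suml mxE; apply: ler_sum => i _.
rewrite [_^T _ _]mxE [col _ _ _ _]mxE -expr2.
have := psdmx_CauchySchwarz (row i A)^T (col j B) (psdmx1 n).
rewrite !mulmx1 trmxK -col_mulmx -row_mul.
by rewrite [col _ _ _ _]mxE [row _ _ _ _]mxE.
Qed.

Lemma fnorm_mulmx m n p (A : 'M[R]_(m, n)) (B : 'M[R]_(n, p)) :
  fnorm (A *m B) <= fnorm A * fnorm B.
Proof.
by rewrite /fnorm -sqrtrM ?frob_ge0// ler_wsqrtr// ler_sqr_mulmx.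
Qed.

Lemma frob_CauchySchwarz m p (A B : 'M[R]_(m, p)) :
  frob A B <= fnorm A * fnorm B.
Proof.
rewrite /fnorm -sqrtrM ?frob_ge0//; apply: le_trans (ler_norm _) _.
rewrite -sqrtr_sqr ler_wsqrtr//.
have := psdmx_CauchySchwarz (mxvec A)^T (mxvec B)^T (psdmx1 (m * p)).
rewrite !mulmx1 !trmxK.
suff vE (C D : 'M[R]_(m, p)) : (mxvec C *m (mxvec D)^T) 0 0 = frob C D.
  by rewrite !vE.
rewrite frobE exchange_big mxE (reindex _ (curry_mxvec_bij m p))/=.
rewrite pair_bigA; apply: eq_bigr => -[i j] _ /=.
by rewrite [_^T _ _]mxE !mxvecE.
Qed.

Lemma psdmx_frob_ge0 n p (A : 'M[R]_n) (P : 'M[R]_(n, p)) : psdmx A ->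
  0 <= frob P (A *m P).
Proof.
move=> [_ Av]; rewrite frob_col; apply: sumr_ge0 => j _.
by rewrite col_mulmx mulmxA.
Qed.

Lemma psdmx_diag_ge0 n (A : 'M[R]_n) i : psdmx A -> 0 <= A i i.
Proof.
move=> [_ /(_ (delta_mx i 0))].
by rewrite trmx_delta -rowE -colE !mxE.
Qed.

Lemma psdmx_tr_ge0 n (A : 'M[R]_n) : psdmx A -> 0 <= \tr A.
Proof. by move=> A0; apply: sumr_ge0 => i _; exact: psdmx_diag_ge0. Qed.

(** The entry [(i, j)] of [A *m P] is the form [A] at the [i]th basis vector and the column [j] of
    [P]. Cauchy-Schwarz for [A] bounds its square by [A i i] times the form at that column; the
    diagonal entries sum to the trace. *)
Lemma psdmx_frob_mulmx n p (A : 'M[R]_n) (P : 'M[R]_(n, p)) : psdmx A ->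
  frob (A *m P) (A *m P) <= \tr A * frob P (A *m P).
Proof.
move=> A0; rewrite frob_col [in leRHS]frob_col mulr_sumr.
apply: ler_sum => j _; rewrite mxE mulr_suml; apply: ler_sum => i _.
rewrite [_^T _ _]mxE [col _ _ _ _]mxE -expr2.
have := psdmx_CauchySchwarz (delta_mx i 0) (col j P) A0.
rewrite trmx_delta -!rowE -!mulmxA -col_mulmx -colE -row_mul.
by rewrite -col_mulmx [col j _ _ _]mxE [col i _ _ _]mxE ![row _ _ _ _]mxE.
Qed.


(** * Pseudoinverses, range inclusions and the pointwise bound *)

Lemma pinverse_sym n (A : 'M[R]_n) : A^T = A -> (pinverse A)^T = pinverse A.
Proof.
move=> As; apply: (@penrose_uniq _ _ _ A); last exact: pinverseP.
have [h1 h2 h3 h4] := pinverseP A.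
split.
- by rewrite -[in RHS]As -[in RHS]h1 !trmx_mul As mulmxA.
- by rewrite -[in RHS]h2 !trmx_mul As mulmxA.
- by rewrite trmx_mul trmxK As -[in LHS]h4 trmx_mul As.
- by rewrite trmx_mul trmxK As -[in LHS]h3 trmx_mul As.
Qed.

(** The identity [A^+ = A^+ A A^+] exhibits [A^+] as a congruence of [A], since [A^+] is
    symmetric. *)
Lemma psdmx_pinverse n (A : 'M[R]_n) : psdmx A -> psdmx (pinverse A).
Proof.
move=> A0; have [_ h2 _ _] := pinverseP A.
rewrite -h2 -[X in X *m _ *m _](pinverse_sym A0.1); exact: psdmx_conj.
Qed.

(** [A A^+] projects onto the range of [A]. The equational form serves both to factor densities and
    to prove measurability. *)
Lemma ran_subP m p q (A : 'M[R]_(m, p)) (B : 'M[R]_(m, q)) :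
  reflect (A *m pinverse A *m B = B) (ran_sub B A).
Proof.
apply: (iffP submxP) => [[D BE]|<-].
  have [h1 _ _ _] := pinverseP A.
  have -> : B = A *m D^T by rewrite -(trmxK B) BE trmx_mul trmxK.
  by rewrite mulmxA h1.
by exists (pinverse A *m B)^T; rewrite -trmx_mul mulmxA.
Qed.

Lemma ran_sub_row_mx m p q s (A : 'M[R]_(m, p)) (B : 'M[R]_(m, q))
    (C : 'M[R]_(m, s)) :
  ran_sub (row_mx A B) C = ran_sub A C && ran_sub B C.
Proof. by rewrite /ran_sub tr_row_mx col_mx_sub. Qed.

Lemma ran_sub0 m p q (A : 'M[R]_(m, p)) : ran_sub (0 : 'M[R]_(m, q)) A.
Proof. by rewrite /ran_sub trmx0 sub0mx. Qed.

Lemma ran_subZ m p q (c d : R) (A : 'M[R]_(m, p)) (B : 'M[R]_(m, q)) :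
  d != 0 -> ran_sub B A -> ran_sub (c *: B) (d *: A).
Proof.
move=> d0; rewrite /ran_sub !linearZ/= => BA.
by rewrite (eqmx_scale _ d0); exact: scalemx_sub.
Qed.

Lemma Jfun_ge0 n k (L1 : 'M[R]_k) (L2 : 'M[R]_n) X Y Z :
  (0 <= Jfun L1 L2 X Y Z)%E.
Proof.
rewrite /Jfun; case: ifPn => // /asboolP[X0 _ _]; rewrite lee_fin.
have P0 := psdmx_pinverse X0.
by rewrite -!mulmxA addr_ge0// mulr_ge0// psdmx_frob_ge0.
Qed.

(** [K] stands for [pinverse L1] or [invmx L2], so that both inequalities of the theorem are
    instances. *)
Lemma fnorm_range_le n k (G : 'M[R]_n) (Y : 'M[R]_(n, k)) (K L : 'M[R]_k) :
  psdmx G -> ran_sub Y G -> Y *m K *m L = Y ->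
  fnorm Y <= fnorm L * (Num.sqrt (\tr G) *
    Num.sqrt (frob (pinverse G *m Y *m K) (G *m (pinverse G *m Y *m K)))).
Proof.
move=> G0 /ran_subP YG YKL; set P := _ *m K.
have -> : Y = G *m P *m L by rewrite /P !mulmxA YG YKL.
rewrite mulrC (le_trans (fnorm_mulmx _ _))// ler_wpM2r ?fnorm_ge0//.
rewrite -sqrtrM ?psdmx_tr_ge0// ler_wsqrtr//.
exact: psdmx_frob_mulmx.
Qed.

(** * Regularised inverses converging to the pseudoinverse *)

Lemma frobDr m p (A B C : 'M[R]_(m, p)) : frob A (B + C) = frob A B + frob A C.
Proof. by rewrite /frob mulmxDr mxtraceD. Qed.

Lemma frobZr m p (A B : 'M[R]_(m, p)) c : frob A (c *: B) = c * frob A B.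
Proof. by rewrite /frob -scalemxAr mxtraceZ. Qed.

Lemma fnormZ m p (A : 'M[R]_(m, p)) c : 0 <= c -> fnorm (c *: A) = c * fnorm A.
Proof.
move=> c0; rewrite /fnorm frobZr frobC frobZr mulrA -expr2 sqrtrM ?sqr_ge0//.
by rewrite sqrtr_sqr ger0_norm.
Qed.

Lemma ler_entry_fnorm m p (A : 'M[R]_(m, p)) i j : `|A i j| <= fnorm A.
Proof.
rewrite -sqrtr_sqr ler_wsqrtr// frobE (bigD1 j)//= (bigD1 i)//= -addrA expr2.
rewrite lerDl addr_ge0//; last apply: sumr_ge0 => k _.
  by apply: sumr_ge0 => k _; rewrite -expr2 sqr_ge0.
by apply: sumr_ge0 => l _; rewrite -expr2 sqr_ge0.
Qed.

Lemma fnorm_eq0 m p (A : 'M[R]_(m, p)) : fnorm A = 0 -> A = 0.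
Proof.
move=> A0; apply/matrixP => i j; rewrite mxE; apply/eqP.
by rewrite -normr_le0 -A0 ler_entry_fnorm.
Qed.

Lemma fnorm0 m p : fnorm (0 : 'M[R]_(m, p)) = 0.
Proof. by rewrite /fnorm /frob mulmx0 mxtrace0 sqrtr0. Qed.

(** Coercivity: pairing [(M + e) U] with [U] gives at least [e |U|^2], and by Cauchy-Schwarz at most
    [|U| |(M + e) U|]. *)
Lemma psdmx_shift_fnorm n p (M : 'M[R]_n) e (U : 'M[R]_(n, p)) :
  psdmx M -> 0 < e -> e * fnorm U <= fnorm ((M + e%:M) *m U).
Proof.
move=> M0 e0; have [->|U0] := eqVneq (fnorm U) 0.
  by rewrite mulr0 fnorm_ge0.
have U1 : 0 < fnorm U by rewrite lt0r U0 fnorm_ge0.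
rewrite -(ler_pM2l U1) (le_trans _ (frob_CauchySchwarz _ _))//.
rewrite mulmxDl frobDr mul_scalar_mx frobZr -sqr_fnorm expr2 mulrCA lerDr.
exact: psdmx_frob_ge0.
Qed.

Lemma psdmx_shift_unit n (M : 'M[R]_n) e :
  psdmx M -> 0 < e -> M + e%:M \in unitmx.
Proof.
move=> M0 e0; rewrite -unitmx_tr -row_free_unit -kermx_eq0; apply/rowV0P => v.
move=> /sub_kermxP vM; apply: trmx_inj; rewrite trmx0; apply: fnorm_eq0.
have := psdmx_shift_fnorm v^T M0 e0.
rewrite -[_ *m v^T]trmxK trmx_mul trmxK vM trmx0 fnorm0 pmulr_rle0// => v0.
by apply/eqP; rewrite eq_le v0 fnorm_ge0.
Qed.

(* With [M = A^T A] and [A^+ = M W], the difference [(M + e)^-1 A^T - A^+] is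
   [- e (M + e)^-1 A^+ = - e (W - e (M + e)^-1 W)]. *)
Lemma pinverse_approx m p (A : 'M[R]_(m, p)) : exists C : R,
  forall e i j, 0 < e ->
  `|(invmx (A^T *m A + e%:M) *m A^T) i j - pinverse A i j| <= e * C.
Proof.
have := pinverseP A; move: (pinverse A) => B [h1 h2 h3 h4].
set M := A^T *m A; pose W := B *m B^T *m B; exists (fnorm W + fnorm W).
move=> e i j e0; have M0 : psdmx M := psdmx_gram A.
have AE : M *m B = A^T by rewrite /M -mulmxA -h3 -trmx_mul h1.
have BE : M *m W = B.
  by rewrite /W -[B *m _ *m _]mulmxA mulmxA AE mulmxA -trmx_mul h4 h2.
have SU := psdmx_shift_unit M0 e0; set S := M + e%:M in SU *.
pose U := invmx S *m (e *: W).
(* Since [S U = e W], coercivity gives [e |U| <= e |W|]: a bound on [U] uniform in [e]. *)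
have UW : fnorm U <= fnorm W.
  have := psdmx_shift_fnorm U M0 e0; rewrite /U mulKVmx//.
  by rewrite (fnormZ W (ltW e0)) ler_pM2l.
have -> : (invmx S *m A^T) i j - B i j = (e *: (U - W)) i j.
  transitivity ((invmx S *m A^T - B) i j); first by rewrite !mxE.
  congr (fun_of_matrix _ i j); apply: (can_inj (mulKmx SU)).
  rewrite mulmxBr mulKVmx// -scalemxAr mulmxBr mulKVmx// /S mulmxDl.
  rewrite mulmxDl BE AE !mul_scalar_mx.
  by rewrite opprD addrA addrN add0r opprD addrCA subrr addr0 scalerN.
clearbody U W S; rewrite mxE normrM gtr0_norm// ler_pM2l// !mxE.
rewrite (le_trans (ler_normB _ _))//.
rewrite lerD ?ler_entry_fnorm//; apply: le_trans UW; exact: ler_entry_fnorm.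
Qed.

End frobenius.

(** * Testing semidefiniteness on integer vectors *)

Section integer_vectors.
Set Implicit Arguments.
Unset Strict Implicit.
Context {R : realType}.

Lemma cvg_floor_div (x : R) :
  (Num.floor (x * m.+1%:R))%:~R / m.+1%:R @[m --> \oo] --> x.
Proof.
apply: (@squeeze_cvgr _ _ _ _ (fun m => x - m.+1%:R^-1) (cst x)).
- apply: nearW => m /=; have m0 : 0 < m.+1%:R :> R by [].
  have /andP[h1 h2] := floor_itv (x * m.+1%:R).
  rewrite ler_pdivrMr// h1 andbT ler_pdivlMr// mulrBl mulVf ?gt_eqF//.
  by rewrite lerBlDr ltW// (lt_le_trans h2)// intrD.
- rewrite -[X in _ --> X]subr0; apply: cvgB; first exact: cvg_cst.
  exact: cvg_harmonic.
- exact: cvg_cst.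
Qed.

(** Integer vectors divided by [m + 1] approximate any vector, and the quadratic form is continuous
    and homogeneous. This leaves countably many conditions, as measurability requires. *)
Lemma psdmx_int n (A : 'M[R]_n) : A^T = A ->
  (forall v : 'cV[int]_n,
     0 <= ((map_mx intr v)^T *m A *m (map_mx intr v : 'cV[R]_n)) 0 0) ->
  psdmx A.
Proof.
move=> As Aint; split=> // v.
have qE (w : 'cV[R]_n) :
    (w^T *m A *m w) 0 0 = \sum_i \sum_j w j 0 * A j i * w i 0.
  rewrite mxE; apply: eq_bigr => i _; rewrite mxE mulr_suml.
  by apply: eq_bigr => j _; rewrite !mxE.
pose u m := map_mx (fun x : R => Num.floor (x * m.+1%:R)) v.
pose w m : 'cV[R]_n := m.+1%:R^-1 *: map_mx intr (u m).
have : (((w m)^T *m A *m w m) 0 0) @[m --> \oo] --> (v^T *m A *m v) 0 0.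
  under eq_cvg do rewrite qE; rewrite qE.
  have wv i : w m i 0 @[m --> \oo] --> v i 0.
    under eq_cvg do rewrite !mxE mulrC; exact: cvg_floor_div.
  apply: cvg_big => [|i _]; first exact: add_continuous.
  apply: cvg_big => [|j _]; first exact: add_continuous.
  by apply: cvgM => //; apply: cvgM => //; exact: cvg_cst.
move=> qv; rewrite -(cvg_lim _ qv)//; apply: limr_ge.
  by apply/cvg_ex; eexists; exact: qv.
apply: nearW => m; rewrite /w.
set z : 'cV[R]_n := map_mx _ _.
have -> : (m.+1%:R^-1 *: z)^T = m.+1%:R^-1 *: z^T by rewrite linearZ.
rewrite -scalemxAl -scalemxAl -scalemxAr scalerA mxE.
by rewrite mulr_ge0 ?mulr_ge0 ?invr_ge0//; exact: Aint.
Qed.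

End integer_vectors.

(** * Measurability of the pseudoinverse, of the domain conditions and of [Jfun] *)

Section matrix_measurability.
Set Implicit Arguments.
Unset Strict Implicit.
Context d (T : measurableType d) {R : realType}.

Definition mx_measurable m p (F : T -> 'M[R]_(m, p)) :=
  forall i j, measurable_fun [set: T] (fun x => F x i j).

Lemma mx_measurable_cst m p (A : 'M[R]_(m, p)) : mx_measurable (fun=> A).
Proof. by move=> i j; exact: measurable_cst. Qed.

Lemma mx_measurable_mul m n p (F : T -> 'M[R]_(m, n)) (H : T -> 'M[R]_(n, p)) :
  mx_measurable F -> mx_measurable H -> mx_measurable (fun x => F x *m H x).
Proof.
move=> mF mH i j; under eq_fun do rewrite mxE.
by apply: measurable_sum => k; exact: measurable_funM.
Qed.

Lemma mx_measurable_add m n (F H : T -> 'M[R]_(m, n)) :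
  mx_measurable F -> mx_measurable H -> mx_measurable (fun x => F x + H x).
Proof.
move=> mF mH i j; under eq_fun do rewrite mxE.
exact: measurable_funD.
Qed.

Lemma mx_measurable_tr m n (F : T -> 'M[R]_(m, n)) :
  mx_measurable F -> mx_measurable (fun x => (F x)^T).
Proof. by move=> mF i j; under eq_fun do rewrite mxE; exact: mF. Qed.

Lemma mx_measurable_row_mx m n p (F : T -> 'M[R]_(m, n))
    (H : T -> 'M[R]_(m, p)) :
  mx_measurable F -> mx_measurable H ->
  mx_measurable (fun x => row_mx (F x) (H x)).
Proof.
move=> mF mH i j; under eq_fun do rewrite mxE.
by case: (fintype.split j) => k; [exact: mF|exact: mH].
Qed.

Lemma measurable_mxtrace n (F : T -> 'M[R]_n) :
  mx_measurable F -> measurable_fun [set: T] (fun x => \tr (F x)).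
Proof. by move=> mF; apply: measurable_sum => i; exact: mF. Qed.

Lemma measurable_frob m n (F H : T -> 'M[R]_(m, n)) :
  mx_measurable F -> mx_measurable H ->
  measurable_fun [set: T] (fun x => frob (F x) (H x)).
Proof.
move=> mF mH; apply: measurable_mxtrace; apply: mx_measurable_mul => //.
exact: mx_measurable_tr.
Qed.

Lemma measurable_det n (F : T -> 'M[R]_n) :
  mx_measurable F -> measurable_fun [set: T] (fun x => \det (F x)).
Proof.
move=> mF; apply: measurable_sum => s; apply: measurable_funM => //.
by apply: measurable_prod => i _; exact: mF.
Qed.

Lemma measurable_invr (f : T -> R) :
  measurable_fun [set: T] f -> measurable_fun [set: T] (fun x => (f x)^-1).
Proof.
move=> mf.
(* Squaring makes the base of the real power nonnegative; where [f] vanishes both sides are 0. *)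
have -> : (fun x => (f x)^-1) = (fun x => f x * (f x ^+ 2) `^ (- 1)).
  apply/funext => x; rewrite powR_inv1 ?sqr_ge0//.
  have [->|f0] := eqVneq (f x) 0; first by rewrite invr0 mul0r.
  by field.
apply: measurable_funM => //.
apply: (@measurableT_comp _ _ _ _ _ _ (@powR R ^~ (- 1)));
  first exact: measurable_powR.
exact: measurable_funX.
Qed.

Lemma measurable_sqrtr (f : T -> R) :
  measurable_fun [set: T] f ->
  measurable_fun [set: T] (fun x => Num.sqrt (f x)).
Proof.
move=> mf.
(* [Num.sqrt] is 0 at negative arguments, whence the truncation. *)
have -> : (fun x => Num.sqrt (f x)) = (fun x => Num.max (f x) 0 `^ 2^-1).
  apply/funext => x; rewrite powR12_sqrt ?le_max ?lexx ?orbT//.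
  by case: (leP (f x) 0) => // f0; rewrite sqrtr0 ler0_sqrtr.
apply: (@measurableT_comp _ _ _ _ _ _ (@powR R ^~ 2^-1));
  first exact: measurable_powR.
by apply: measurable_maxr => //; exact: measurable_cst.
Qed.

Lemma measurable_fnorm m n (F : T -> 'M[R]_(m, n)) :
  mx_measurable F -> measurable_fun [set: T] (fun x => fnorm (F x)).
Proof. by move=> mF; apply: measurable_sqrtr; exact: measurable_frob. Qed.

(** By Cramer's rule the entries are cofactors divided by the determinant. *)
Lemma mx_measurable_inv n (F : T -> 'M[R]_n) :
  (forall x, F x \in unitmx) ->
  mx_measurable F -> mx_measurable (fun x => invmx (F x)).
Proof.
move=> FU mF i j.
under eq_fun do rewrite /invmx FU mxE mxE.
apply: measurable_funM; first by apply: measurable_invr; exact: measurable_det.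
apply: measurable_funM => //; apply: measurable_det => k l.
by under eq_fun do rewrite !mxE; exact: mF.
Qed.

(** The pseudoinverse need not be continuous, but it is the pointwise limit of
    [(F^T F + 1/(k+1))^-1 F^T], measurable by Cramer's rule. The constant in the error bound may
    depend on [x]. *)
Lemma mx_measurable_pinverse m n (F : T -> 'M[R]_(m, n)) :
  mx_measurable F -> mx_measurable (fun x => pinverse (F x)).
Proof.
move=> mF i j.
pose S k x := (F x)^T *m F x + (k.+1%:R^-1)%:M.
apply: (@measurable_fun_cvg _ _ _ _
  (fun k x => (invmx (S k x) *m (F x)^T) i j)) => [k|x _].
  apply: mx_measurable_mul; last exact: mx_measurable_tr.
  apply: mx_measurable_inv => [x|].
    by apply: psdmx_shift_unit; [exact: psdmx_gram|rewrite invr_gt0].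
  apply: mx_measurable_add; last exact: mx_measurable_cst.
  by apply: mx_measurable_mul => //; exact: mx_measurable_tr.
have [C HC] := pinverse_approx (F x).
apply/subr_cvg0/norm_cvg0P.
apply: (@squeeze_cvgr _ _ _ _ (cst 0) (fun k => k.+1%:R^-1 * C)).
- by apply: nearW => k /=; rewrite normr_ge0/= HC// invr_gt0.
- exact: cvg_cst.
- rewrite -[X in _ --> X](mul0r C); apply: cvgM; last exact: cvg_cst.
  exact: cvg_harmonic.
Qed.

Lemma measurable_mx_eq m n (F H : T -> 'M[R]_(m, n)) :
  mx_measurable F -> mx_measurable H ->
  measurable_fun [set: T] (fun x => F x == H x).
Proof.
move=> mF mH.
have -> : (fun x => F x == H x) = (fun x => fnorm (F x + (- 1)%:M *m H x) == 0).
  apply/funext => x; rewrite mul_scalar_mx scaleN1r.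
  apply/eqP/eqP => [->|/fnorm_eq0/eqP]; first by rewrite subrr fnorm0.
  by rewrite subr_eq0 => /eqP.
apply: measurable_fun_eqr; last exact: measurable_cst.
apply: measurable_fnorm; apply: mx_measurable_add => //.
by apply: mx_measurable_mul => //; exact: mx_measurable_cst.
Qed.

Lemma measurable_ran_sub m n p (F : T -> 'M[R]_(m, n)) (H : T -> 'M[R]_(m, p)) :
  mx_measurable F -> mx_measurable H ->
  measurable_fun [set: T] (fun x => ran_sub (F x) (H x)).
Proof.
move=> mF mH.
have -> : (fun x => ran_sub (F x) (H x)) =
    (fun x => H x *m pinverse (H x) *m F x == F x).
  by apply/funext => x; apply/ran_subP/eqP.
apply: measurable_mx_eq => //.
do 2 apply: mx_measurable_mul => //; exact: mx_measurable_pinverse.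
Qed.

Lemma measurable_psdmx n (F : T -> 'M[R]_n) :
  mx_measurable F -> measurable_fun [set: T] (fun x => `[< psdmx (F x) >]).
Proof.
move=> mF.
pose q (v : 'cV[int]_n) x :=
  ((map_mx intr v)^T *m F x *m (map_mx intr v : 'cV[R]_n)) 0 0.
(* Enumerates the tests over all integer vectors; numbers coding no vector give the vacuous test. *)
pose Q k x := if unpickle k is Some v then 0 <= q v x else true.
have mQ k : measurable_fun setT (Q k).
  rewrite /Q; case: unpickle => [v|]; last exact: measurable_cst.
  apply: measurable_fun_ler; first exact: measurable_cst.
  by do 2?apply: mx_measurable_mul => //; exact: mx_measurable_cst.
apply: (measurable_fun_bool true); rewrite setTI.
have -> : (fun x => `[< psdmx (F x) >]) @^-1` [set true] =
    [set x | (F x)^T == F x] `&` \bigcap_k [set x | Q k x].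
  apply/seteqP; split => x /=.
    move=> /asboolP[Fs Fv]; split; first exact/eqP.
    by move=> k _ /=; rewrite /Q; case: unpickle => [v|//]; exact: Fv.
  move=> [/eqP Fs FQ]; apply/asboolP; apply: psdmx_int => // v.
  by have := FQ (pickle v) I; rewrite /= /Q pickleK.
have mb (f : T -> bool) : measurable_fun setT f -> measurable [set x | f x].
  by move=> mf; rewrite -[X in measurable X]setTI; exact: mf.
apply: measurableI.
  by apply: mb; apply: measurable_mx_eq => //; exact: mx_measurable_tr.
by apply: bigcapT_measurable => k; exact: mb.
Qed.

(** Needed to pass from a finite integral of [Jfun] to its finiteness almost everywhere. *)
Lemma measurable_Jfun n k (L1 : 'M[R]_k) (L2 : 'M[R]_n) F
    (H : T -> 'M[R]_(n, k)) W :
  mx_measurable F -> mx_measurable H -> mx_measurable W ->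
  measurable_fun [set: T] (fun x => Jfun L1 L2 (F x) (H x) (W x)).
Proof.
move=> mF mH mW; apply: measurable_fun_ifT; last exact: measurable_cst.
  have -> : (fun x => `[< [/\ psdmx (F x), ran_sub (H x)^T L1 &
        ran_sub (row_mx (H x) (W x)) (F x)] >]) =
      (fun x => [&& `[< psdmx (F x) >], ran_sub (H x)^T L1 &
        ran_sub (row_mx (H x) (W x)) (F x)]).
    by apply/funext => x; apply/asboolP/and3P => -[? ? ?]; split=> //;
      apply/asboolP.
  apply: measurable_and; last apply: measurable_and.
  - exact: measurable_psdmx.
  - apply: measurable_ran_sub; first exact: mx_measurable_tr.
    exact: mx_measurable_cst.
  - by apply: measurable_ran_sub => //; exact: mx_measurable_row_mx.
apply/measurable_EFinP.
have mP := mx_measurable_pinverse mF.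
apply: measurable_funD; apply: measurable_funM => //; apply: measurable_frob;
  do ?apply: mx_measurable_mul => //; exact: mx_measurable_cst.
Qed.

End matrix_measurability.

(** * The sum of two finite measures, dominating both *)

Section finite_measure_sum.
Set Implicit Arguments.
Unset Strict Implicit.
Context d (T : measurableType d) (R : realType).
Variables (m1 m2 : {finite_measure set T -> \bar R}).

Definition finite_measure_sum : set T -> \bar R := measure_add m1 m2.

HB.instance Definition _ := Measure.on finite_measure_sum.

Lemma finite_measure_sum_fin : fin_num_fun finite_measure_sum.
Proof.
move=> A mA.
by rewrite /finite_measure_sum measure_addE fin_numD !fin_num_measure.
Qed.

HB.instance Definition _ :=
  Measure_isFinite.Build _ _ _ finite_measure_sum finite_measure_sum_fin.

Lemma finite_measure_suml : m1 `<< finite_measure_sum.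
Proof.
apply/null_content_dominatesP => A mA.
rewrite [X in X = _ -> _](measure_addE m1 m2 A) => /eqP.
by rewrite padde_eq0// => /andP[/eqP].
Qed.

Lemma finite_measure_sumr : m2 `<< finite_measure_sum.
Proof.
apply/null_content_dominatesP => A mA.
rewrite [X in X = _ -> _](measure_addE m1 m2 A) => /eqP.
by rewrite padde_eq0// => /andP[_ /eqP].
Qed.

End finite_measure_sum.

(** * Comparing densities for two reference measures *)

Section density_transfer.
Set Implicit Arguments.
Unset Strict Implicit.
Context d (T : measurableType d) (R : realType).
Implicit Types (nu : {charge set T -> \bar R}).
Implicit Types (la mu : {finite_measure set T -> \bar R}).

(** The derivative is taken of a charge, so its sign is only known almost everywhere, by comparison
    with the nonnegative density of the measure. *)
Lemma Radon_Nikodym_ae_ge0 mu la : mu `<< la ->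
  {ae la, forall x, (0 <= Radon_Nikodym (charge_of_finite_measure mu) la x)%E}.
Proof.
move=> mula; have := ae_eq_Radon_Nikodym_SigmaFinite mula measurableT.
by apply: filterS => x /(_ I) <-; exact: Radon_Nikodym_SigmaFinite.f_ge0.
Qed.

Lemma ae_Radon_Nikodym_neq0 mu la : mu `<< la ->
  {ae mu, forall x, Radon_Nikodym (charge_of_finite_measure mu) la x != 0%E}.
Proof.
move=> mula; set f := Radon_Nikodym _ la.
have mf : measurable_fun setT f.
  by apply: (measurable_int la); exact: Radon_Nikodym_integrable.
have mN : measurable [set x | f x == 0%E].
  rewrite -[X in measurable X]setTI.
  by apply: (measurable_fun_eqe mf (measurable_cst 0%E)).
exists [set x | f x == 0%E]; split => //.
- transitivity (\int[la]_(x in [set x | f x == 0%E]) f x)%E.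
    exact: (@Radon_Nikodym_integral _ _ _ (charge_of_finite_measure mu)).
  rewrite (eq_integral (cst 0%E)) ?integral0// => x.
  by rewrite inE => /eqP.
- by move=> x /= /negP; rewrite negbK.
Qed.

(** On a [mu]-null set the density of [mu] has integral 0, and being nonnegative it vanishes there
    [la]-almost everywhere. *)
Lemma ae_Radon_Nikodym_transfer mu la (P : T -> Prop) : mu `<< la ->
  {ae mu, forall x, P x} ->
  {ae la, forall x, Radon_Nikodym (charge_of_finite_measure mu) la x != 0%E ->
    P x}.
Proof.
move=> mula [N [mN N0 PN]]; set f := Radon_Nikodym _ la.
have mf : measurable_fun setT f.
  by apply: (measurable_int la); exact: Radon_Nikodym_integrable.
have mfN : measurable_fun N f by exact: measurable_funS mf.
have f0 : (\int[la]_(x in N) `|f x| = 0)%E.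
  rewrite -N0; transitivity (\int[la]_(x in N) f x)%E; last first.
    apply/esym.
    exact: (@Radon_Nikodym_integral _ _ _ (charge_of_finite_measure mu)).
  apply: ae_eq_integral => //; first exact: measurableT_comp.
  apply: filterS (Radon_Nikodym_ae_ge0 mula) => x fx _.
  by rewrite gee0_abs.
have := (ae_eq_integral_abs la mN mfN).1 f0; apply: filterS => x Nf fx.
apply: contrapT => Px; move: fx; rewrite Nf ?eqxx//; exact: PN.
Qed.

(** With [a], [b] the densities of [la0], [la] for their sum, the chain rule computes the density of
    [nu] for the sum in two ways; dividing by [b], nonzero [la]-almost everywhere, gives the factor
    [a / b]. It is the same for every [nu]. *)
Lemma density_proportional la0 la : exists c : T -> R,
  [/\ forall x, 0 <= c x,
      forall nu, nu `<< la0 -> nu `<< la ->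
        {ae la, forall x, fine (Radon_Nikodym nu la x) =
                          c x * fine (Radon_Nikodym nu la0 x)} &
      forall P : T -> Prop, {ae la0, forall x, P x} ->
        {ae la, forall x, c x != 0 -> P x}].
Proof.
pose s : {finite_measure set T -> \bar R} := finite_measure_sum la0 la.
have la0s : la0 `<< s := @finite_measure_suml _ _ _ la0 la.
have las : la `<< s := @finite_measure_sumr _ _ _ la0 la.
pose a := Radon_Nikodym (charge_of_finite_measure la0) s.
pose b := Radon_Nikodym (charge_of_finite_measure la) s.
have afin x : a x \is a fin_num by exact: Radon_Nikodym_fin_num.
have bfin x : b x \is a fin_num by exact: Radon_Nikodym_fin_num.
have s_la (P : T -> Prop) : {ae s, forall x, P x} -> {ae la, forall x, P x}.
  move=> [N [mN N0 PN]]; exists N; split => //.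
  exact: (null_content_dominatesP _ _).1 las _ mN N0.
have b0 := ae_Radon_Nikodym_neq0 las.
(* The absolute value gives nonnegativity everywhere and changes nothing almost everywhere. *)
exists (fun x => `|fine (a x) / fine (b x)|); split => //.
- move=> nu nula0 nula.
  have e0 := Radon_Nikodym_chain_rule nula0 la0s.
  have e1 := Radon_Nikodym_chain_rule nula las.
  have /s_la e : {ae s, forall x, fine (Radon_Nikodym nu la0 x) * fine (a x) =
      fine (Radon_Nikodym nu la x) * fine (b x)}.
    move: e0 e1; apply: filterS2 => x /(_ I) e0 /(_ I) e1.
    by rewrite -!fineM ?Radon_Nikodym_fin_num// -[in LHS]e0 -[in RHS]e1.
  have a_ge0 := s_la _ (Radon_Nikodym_ae_ge0 la0s).
  have b_ge0 := s_la _ (Radon_Nikodym_ae_ge0 las).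
  apply: filterS3 e b0 (filterI a_ge0 b_ge0) => x ex bx [ax0 bx0].
  rewrite ger0_norm ?divr_ge0 ?fine_ge0//.
  have bx1 : fine (b x) != 0 by rewrite fine_eq0.
  by rewrite mulrAC [X in X / _]mulrC ex mulfK.
(* A nonzero quotient forces [a x != 0], where properties true [la0]-almost everywhere pass to the
   sum. *)
- move=> P /(ae_Radon_Nikodym_transfer la0s)/s_la; apply: filterS => x aP.
  by rewrite normr_eq0 mulf_eq0 negb_or fine_eq0// => /andP[/aP].
Qed.

End density_transfer.

(** * Domination of the entries by way of the total variation *)

Section total_variation_bounds.
Set Implicit Arguments.
Unset Strict Implicit.
Context d (T : measurableType d) (R : realType).

Lemma le_total_variation (N : set T -> R) (E : set T) :
  (forall A, 0 <= N A) -> N set0 = 0 -> measurable E ->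
  ((N E)%:E <= Defs.total_variation N E)%E.
Proof.
move=> N0 N00 mE; apply: ereal_sup_ubound.
(* The trivial partition: [E] followed by empty sets. *)
exists (fun i => if i is 0%N then E else set0); split.
- by case.
- by apply/trivIsetP => -[|i] [|j] _ _ //= _; rewrite ?setI0 ?set0I.
- by apply/seteqP; split => [x [[|i] _]//|x Ex]; exists 0%N.
- rewrite nneseries_recl//; last by move=> k _; rewrite lee_fin.
  by rewrite eseries0 ?adde0// => -[//|i] _ _; rewrite N00.
Qed.

Lemma mxval0 m p (nu : mxmeasure T m p) : mxval (R := R) nu set0 = 0.
Proof. by apply/matrixP => i j; rewrite !mxE charge0. Qed.

(** On a [lam]-null set the total variation is 0 and bounds the norm of the triple's value, so every
    entry vanishes. This provides the entrywise densities. *)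
Lemma Xtv_dominates n k (G : mxmeasure T n n) (q : mxmeasure T n k)
    (r : mxmeasure T n n) (lam : {finite_measure set T -> \bar R}) :
  Xtv G q r `<< lam ->
  [/\ forall i j, G i j `<< lam, forall i j, q i j `<< lam &
      forall i j, r i j `<< lam].
Proof.
move=> /null_content_dominatesP Xlam.
suff H A : measurable A -> lam A = 0%E ->
    [/\ mxval G A = 0, mxval q A = 0 & mxval r A = 0].
  have entry m p (nu : mxmeasure T m p) i j A : measurable A ->
      mxval nu A = 0 -> nu i j A = 0%E.
    move=> mA /matrixP/(_ i j); rewrite !mxE => nu0.
    by rewrite -[LHS]fineK ?nu0// fin_num_measure.
  by split=> i j; apply/null_content_dominatesP => A mA /(H _ mA)[? ? ?];
    exact: entry.
move=> mA lamA.
have : ((Num.sqrt (fnorm (mxval G A) ^+ 2 + fnorm (mxval q A) ^+ 2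
              + fnorm (mxval r A) ^+ 2))%:E <= 0)%E.
  rewrite -(Xlam A mA lamA); apply: (@le_total_variation (fun A =>
    Num.sqrt (fnorm (mxval G A) ^+ 2 + fnorm (mxval q A) ^+ 2
              + fnorm (mxval r A) ^+ 2))) => //.
  by rewrite !mxval0 !fnorm0 expr0n !addr0 sqrtr0.
rewrite lee_fin => s0.
have /eqP : Num.sqrt (fnorm (mxval G A) ^+ 2 + fnorm (mxval q A) ^+ 2
              + fnorm (mxval r A) ^+ 2) = 0.
  by apply/eqP; rewrite eq_le s0 sqrtr_ge0.
rewrite sqrtr_eq0 => {}s0.
have [a0 b0 c0] : [/\ 0 <= fnorm (mxval G A) ^+ 2, 0 <= fnorm (mxval q A) ^+ 2 &
  0 <= fnorm (mxval r A) ^+ 2] by rewrite !sqr_ge0.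
split; apply: fnorm_eq0; apply/eqP; rewrite -sqrf_eq0; apply/eqP; lra.
Qed.

End total_variation_bounds.

(** * Cauchy-Schwarz for integrals over a set *)

Section integral_CauchySchwarz.
Set Implicit Arguments.
Unset Strict Implicit.
Context d (T : measurableType d) (R : realType).
Variable mu : {measure set T -> \bar R}.

Lemma Lnorm2_sqrt_patch (f : T -> R) E : measurable E ->
  measurable_fun [set: T] f ->
  {ae mu, forall x, E x -> 0 <= f x} ->
  ('N[mu]_2%:E[EFin \o (fun x => Num.sqrt (f x)) \_ E] =
    sqrte (\int[mu]_(x in E) (f x)%:E))%E.
Proof.
move=> mE mf f0.
have If0 : (0 <= \int[mu]_x (`|((fun x => Num.sqrt (f x)) \_ E) x| `^ 2)%:E)%E.
  by apply: integral_ge0 => x _; rewrite lee_fin powR_ge0.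
have mfE : measurable_fun E (EFin \o f).
  by apply/measurable_EFinP; exact: measurable_funTS.
rewrite unlock /= poweR12_sqrt//; congr sqrte.
rewrite [RHS]integral_mkcond; apply: ae_eq_integral => //.
- apply/measurable_EFinP.
  apply: (@measurableT_comp _ _ _ _ _ _ (@powR R ^~ 2));
    first exact: measurable_powR.
  apply: measurableT_comp => //.
  apply/(measurable_restrictT _ mE); apply: measurable_funTS.
  exact: measurable_sqrtr.
- by apply/(measurable_restrictT _ mE).
- apply: filterS f0 => x fx _ /=; rewrite !patchE.
  case: ifPn => [/set_mem/fx {}fx|_].
    by rewrite powR_mulrn// ger0_norm ?sqrtr_ge0// sqr_sqrtr.
  by rewrite normr0 powR0.
Qed.

(** Hölder's inequality with exponents 2 and 2 for the square roots extended by 0 outside [E].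
    Nonnegativity is asked only almost everywhere, as semidefiniteness of the densities is known
    only so. *)
Lemma integral_CauchySchwarz (f g : T -> R) E : measurable E ->
  measurable_fun [set: T] f -> measurable_fun [set: T] g ->
  {ae mu, forall x, E x -> 0 <= f x} -> {ae mu, forall x, E x -> 0 <= g x} ->
  (\int[mu]_(x in E) (Num.sqrt (f x) * Num.sqrt (g x))%:E <=
   sqrte (\int[mu]_(x in E) (f x)%:E) * sqrte (\int[mu]_(x in E) (g x)%:E))%E.
Proof.
move=> mE mf mg f0 g0; rewrite -!Lnorm2_sqrt_patch//.
have mp (h : T -> R) : measurable_fun setT h ->
    measurable_fun setT ((fun x => Num.sqrt (h x)) \_ E).
  move=> mh; apply/(measurable_restrictT _ mE); apply: measurable_funTS.
  exact: measurable_sqrtr.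
have := hoelder mu (mp _ mf) (mp _ mg).
move=> /(_ 2 2); rewrite ltr0n => /(_ isT isT) H.
apply: le_trans (H _); last by field.
rewrite Lnorm1 integral_mkcond le_eqVlt; apply/orP; left; apply/eqP.
apply: eq_integral => x _; rewrite /= !patchE; case: ifPn => _.
  by rewrite ger0_norm// mulr_ge0 ?sqrtr_ge0.
by rewrite mulr0 normr0.
Qed.

End integral_CauchySchwarz.

(** * Bounding the total variation by integrals of densities *)

Section total_variation_bound.
Set Implicit Arguments.
Unset Strict Implicit.
Context d (T : measurableType d) (R : realType).
Variable lam : {finite_measure set T -> \bar R}.

Lemma mx_measurable_density m p (nu : mxmeasure T m p) :
  (forall i j, nu i j `<< lam) -> mx_measurable (mxdensity nu lam).
Proof.
move=> nulam i j; under eq_fun do rewrite mxE.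
apply: measurableT_comp; first exact: fine_measurable.
by apply: (measurable_int lam); exact: Radon_Nikodym_integrable.
Qed.

Lemma integrable_density m p (nu : mxmeasure T m p) i j A :
  (forall i j, nu i j `<< lam) -> measurable A ->
  lam.-integrable A (fun x => (mxdensity nu lam x i j)%:E).
Proof.
move=> nulam mA; apply: (integrableS measurableT) => //.
rewrite (_ : (fun x => _) = Radon_Nikodym (nu i j) lam).
  exact: Radon_Nikodym_integrable.
by apply/funext => x; rewrite mxE fineK// Radon_Nikodym_fin_num.
Qed.

Lemma integral_density m p (nu : mxmeasure T m p) i j A :
  (forall i j, nu i j `<< lam) -> measurable A ->
  (\int[lam]_(x in A) (mxdensity nu lam x i j)%:E = (mxval nu A i j)%:E)%E.
Proof.
move=> nulam mA; rewrite mxE fineK ?fin_num_measure//.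
rewrite (Radon_Nikodym_integral (nulam i j) mA); apply: eq_integral => x _.
by rewrite mxE fineK// Radon_Nikodym_fin_num.
Qed.

(** Used with [C] the value [mxval nu A] for the norm bound, and with [C] the identity for the
    trace. *)
Lemma integral_frob_density m p (nu : mxmeasure T m p) (C : 'M[R]_(m, p)) A :
  (forall i j, nu i j `<< lam) -> measurable A ->
  (\int[lam]_(x in A) (frob C (mxdensity nu lam x))%:E =
   (frob C (mxval nu A))%:E)%E.
Proof.
move=> nulam mA.
under eq_integral do rewrite frobE -sumEFin.
have H j i : lam.-integrable A (fun x => (C i j * mxdensity nu lam x i j)%:E).
  under eq_fun do rewrite EFinM.
  by apply: integrableZl => //; exact: integrable_density.
rewrite integral_sum//; last first.
  move=> j; under eq_fun do rewrite -sumEFin; exact: integrable_sum.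
rewrite frobE -sumEFin; apply: eq_bigr => j _.
under eq_integral do rewrite -sumEFin.
rewrite integral_sum// -sumEFin; apply: eq_bigr => i _.
under eq_integral do rewrite EFinM.
by rewrite integralZl// ?integral_density ?EFinM//; exact: integrable_density.
Qed.

Lemma frob1 n (A : 'M[R]_n) : frob 1%:M A = \tr A.
Proof. by rewrite /frob trmx1 mul1mx. Qed.

(** With [v] the value at [A], [|v|^2] is the integral of the pairing of [v] with the density, hence
    at most [|v|] times the right-hand side; then divide by [|v|]. *)
Lemma fnorm_mxval_le m p (nu : mxmeasure T m p) A :
  (forall i j, nu i j `<< lam) -> measurable A ->
  ((fnorm (mxval nu A))%:E <=
   \int[lam]_(x in A) (fnorm (mxdensity nu lam x))%:E)%E.
Proof.
move=> nulam mA; set v := mxval nu A.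
have md := mx_measurable_density nulam.
have mfd : measurable_fun A (fun x => (fnorm (mxdensity nu lam x))%:E).
  by apply/measurable_EFinP; apply: measurable_funTS; exact: measurable_fnorm.
have [->|v0] := eqVneq (fnorm v) 0.
  by apply: integral_ge0 => x _; rewrite lee_fin fnorm_ge0.
have v1 : 0 < fnorm v by rewrite lt0r v0 fnorm_ge0.
rewrite -(lee_pmul2l _ (x := (fnorm v)%:E))//.
rewrite -EFinM -expr2 sqr_fnorm -[in leLHS]integral_frob_density//.
rewrite -ge0_integralZl ?lee_fin ?fnorm_ge0//; last first.
  by move=> x _; rewrite lee_fin fnorm_ge0.
have mfrob : measurable_fun A (fun x => (frob v (mxdensity nu lam x))%:E).
  apply/measurable_EFinP; apply: measurable_funTS.
  exact: measurable_frob (mx_measurable_cst v) md.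
rewrite (le_trans (lee_abs _))// (le_trans (le_abse_integral _ _ _))//.
apply: ge0_le_integral => //.
- exact: measurableT_comp.
- exact: emeasurable_funM.
move=> x _; rewrite lee_fin ler_norml frob_CauchySchwarz andbT lerNl.
(* [frob_CauchySchwarz] is one-sided; applied to [- v] it gives the lower bound. *)
have := frob_CauchySchwarz (- v) (mxdensity nu lam x).
have -> : frob (- v) (mxdensity nu lam x) = - frob v (mxdensity nu lam x).
  by rewrite frobC -scaleN1r frobZr mulN1r frobC.
have -> // : fnorm (- v) = fnorm v.
by rewrite /fnorm -scaleN1r frobZr frobC frobZr mulrA mulrNN !mul1r.
Qed.

(** For each partition, the bounds on the pieces add up to the integral over [E] by countable
    additivity. *)
Lemma mxtv_le_integral m p (nu : mxmeasure T m p) E :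
  (forall i j, nu i j `<< lam) -> measurable E ->
  (mxtv nu E <= \int[lam]_(x in E) (fnorm (mxdensity nu lam x))%:E)%E.
Proof.
move=> nulam mE; apply: ge_ereal_sup => _ [F [mF tF UF ->]].
rewrite -UF ge0_integral_bigcup//; last 2 first.
- apply/measurable_EFinP; apply: measurable_funTS; apply: measurable_fnorm.
  exact: mx_measurable_density.
- by move=> x _; rewrite lee_fin fnorm_ge0.
apply: lee_nneseries => [i _ _|i _]; first by rewrite lee_fin fnorm_ge0.
exact: fnorm_mxval_le.
Qed.

Lemma mxtv_range_le n k (G : mxmeasure T n n) (q : mxmeasure T n k)
    (K L : 'M[R]_k) E :
  (forall i j, G i j `<< lam) -> (forall i j, q i j `<< lam) ->
  {ae lam, forall x, [/\ psdmx (mxdensity G lam x),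
     ran_sub (mxdensity q lam x) (mxdensity G lam x) &
     mxdensity q lam x *m K *m L = mxdensity q lam x]} ->
  measurable E ->
  (mxtv q E <= (Num.sqrt (\tr (mxval G E)) * fnorm L)%:E
     * L2norm G lam E (fun x =>
         pinverse (mxdensity G lam x) *m mxdensity q lam x *m K))%E.
Proof.
move=> Glam qlam good mE.
set P := fun x : T => _.
have mG := mx_measurable_density Glam.
have mq := mx_measurable_density qlam.
have mP : mx_measurable P.
  apply: mx_measurable_mul; last exact: mx_measurable_cst.
  by apply: mx_measurable_mul => //; exact: mx_measurable_pinverse.
have mtr := measurable_mxtrace mG.
have mb : measurable_fun setT (fun x => frob (P x) (mxdensity G lam x *m P x)).
  by apply: measurable_frob => //; exact: mx_measurable_mul.
have ms : measurable_fun setT (fun x => Num.sqrt (\tr (mxdensity G lam x)) *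
    Num.sqrt (frob (P x) (mxdensity G lam x *m P x))).
  by apply: measurable_funM; exact: measurable_sqrtr.
have trE : (\int[lam]_(x in E) (\tr (mxdensity G lam x))%:E =
    (\tr (mxval G E))%:E)%E.
  under eq_integral do rewrite -frob1.
  by rewrite integral_frob_density// frob1.
apply: le_trans (mxtv_le_integral qlam mE) _.
apply: (@le_trans _ _ (\int[lam]_(x in E) ((fnorm L)%:E *
    (Num.sqrt (\tr (mxdensity G lam x)) *
     Num.sqrt (frob (P x) (mxdensity G lam x *m P x)))%:E))%E).
  apply: ae_ge0_le_integral => //.
  - by move=> x _; rewrite lee_fin fnorm_ge0.
  - apply/measurable_EFinP; apply: measurable_funTS; exact: measurable_fnorm.
  - move=> x _.
    by rewrite -EFinM lee_fin mulr_ge0 ?fnorm_ge0 ?mulr_ge0 ?sqrtr_ge0.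
  - under eq_fun do rewrite -EFinM.
    apply/measurable_EFinP; apply: measurable_funTS.
    by apply: measurable_funM => //; exact: measurable_cst.
  - apply: filterS good => x [? ? ?] _.
    by rewrite -EFinM lee_fin fnorm_range_le.
rewrite ge0_integralZl ?lee_fin ?fnorm_ge0//; last first.
  by apply/measurable_EFinP; exact: measurable_funTS.
(* With [fnorm L] cancelled, Cauchy-Schwarz separates the trace, whose integral is
   [\tr (mxval G E)], from the squared [L2norm]. *)
rewrite mulrC EFinM -muleA lee_wpmul2l ?lee_fin ?fnorm_ge0//.
have := integral_CauchySchwarz (mu := lam) mE mtr mb.
rewrite trE; apply.
- by apply: filterS good => x [? _ _] _; exact: psdmx_tr_ge0.
- by apply: filterS good => x [? _ _] _; exact: psdmx_frob_ge0.
Qed.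

End total_variation_bound.

(** * Consequences of a finite action for the densities *)

Section finite_action.
Set Implicit Arguments.
Unset Strict Implicit.
Context {R : realType}.

Lemma pdmx_unit n (A : 'M[R]_n) : pdmx A -> A \in unitmx.
Proof.
move=> [_ A0]; rewrite -row_free_unit -kermx_eq0; apply/rowV0P => v.
move=> /sub_kermxP vA; apply: contrapT => /eqP v0.
have := A0 v^T; rewrite trmxK vA mul0mx mxE ltxx => H; apply: notF; apply: H.
by apply: contra_neq v0 => /(congr1 trmx); rewrite trmxK trmx0.
Qed.

Lemma ran_sub_symP n k (A : 'M[R]_k) (Y : 'M[R]_(n, k)) : symmx A ->
  ran_sub Y^T A -> Y *m pinverse A *m A = Y.
Proof.
move=> As /ran_subP/(congr1 trmx).
by rewrite !trmx_mul trmxK (pinverse_sym As) As mulmxA.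
Qed.

(** The case condition of [Jfun], isolated because it passes from [lam0] to [lam]. *)
Definition Jdomain n k (L1 : 'M[R]_k) (X : 'M[R]_n) (Y : 'M[R]_(n, k))
    (Z : 'M[R]_n) :=
  [/\ psdmx X, ran_sub Y^T L1 & ran_sub (row_mx Y Z) X].

Lemma JdomainZ n k (L1 : 'M[R]_k) (X : 'M[R]_n) (Y : 'M[R]_(n, k)) Z c :
  0 <= c -> (c != 0 -> Jdomain L1 X Y Z) ->
  Jdomain L1 (c *: X) (c *: Y) (c *: Z).
Proof.
move=> c0; have [-> _|cn0 /(_ isT)[X0 YL XYZ]] := eqVneq c 0.
  rewrite !scale0r; split; first exact: psdmx0.
    by rewrite trmx0 ran_sub0.
  by rewrite row_mx0 ran_sub0.
split; first exact: psdmxZ.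
- have := ran_subZ c (oner_neq0 R) YL; rewrite scale1r.
  by have -> : (c *: Y)^T = c *: Y^T by rewrite linearZ.
- by rewrite -scale_row_mx; exact: ran_subZ.
Qed.

Context d (T : measurableType d).
Variables (n k : nat) (L1 : 'M[R]_k) (L2 : 'M[R]_n).
Variables (G : @mxmeasure _ T R n n) (q : @mxmeasure _ T R n k).
Variable r : @mxmeasure _ T R n n.
Implicit Types lam : {finite_measure set T -> \bar R}.

Lemma Jint_lty_ae lam : Xtv G q r `<< lam ->
  (Jint G q r L1 L2 lam < +oo)%E ->
  {ae lam, forall x, Jdomain L1
    (mxdensity G lam x) (mxdensity q lam x) (mxdensity r lam x)}.
Proof.
move=> /Xtv_dominates[Glam qlam rlam] Joo.
have /(integrable_ae measurableT) : lam.-integrable setT (fun x => Jfun L1 L2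
    (mxdensity G lam x) (mxdensity q lam x) (mxdensity r lam x)).
  apply/integrableP; split.
    by apply: measurable_Jfun; exact: mx_measurable_density.
  by under eq_integral do rewrite gee0_abs ?Jfun_ge0//.
by apply: filterS => x /(_ I); rewrite /Jfun; case: ifPn => // /asboolP.
Qed.

(** Neither reference measure need dominate the other. All three densities scale by the same factor
    [c x], so [JdomainZ] applies. *)
Lemma Jdomain_ae lam0 lam :
  Xtv G q r `<< lam0 -> (Jint G q r L1 L2 lam0 < +oo)%E ->
  Xtv G q r `<< lam ->
  {ae lam, forall x, Jdomain L1
    (mxdensity G lam x) (mxdensity q lam x) (mxdensity r lam x)}.
Proof.
move=> Xlam0 Joo /Xtv_dominates[Glam qlam rlam].
have [Glam0 qlam0 rlam0] := Xtv_dominates Xlam0.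
have [c [c0 dens good]] := density_proportional lam0 lam.
have mxdens m p (nu : mxmeasure T m p) :
    (forall i j, nu i j `<< lam0) -> (forall i j, nu i j `<< lam) ->
    {ae lam, forall x, mxdensity nu lam x = c x *: mxdensity nu lam0 x}.
  move=> nulam0 nulam.
  have : {ae lam, forall x i j, fine (Radon_Nikodym (nu i j) lam x) =
      c x * fine (Radon_Nikodym (nu i j) lam0 x)}.
    (* There are finitely many entries, so the exceptional sets unite to a null set. *)
    by do 2!apply: filter_forall => ?; exact: dens.
  by apply: filterS => x nux; apply/matrixP => i j; rewrite !mxE.
have {}good := good _ (Jint_lty_ae Xlam0 Joo).
apply: filterS3 (mxdens _ _ _ Glam0 Glam) (filterI
  (mxdens _ _ _ qlam0 qlam) (mxdens _ _ _ rlam0 rlam)) good => x -> [-> ->].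
exact: JdomainZ.
Qed.

End finite_action.

Theorem lemma3p12 (R : realType) (X : pmetricType R) (n k : nat)
    (L1 : 'M[R]_k) (L2 : 'M[R]_n)
    (G : mxmeasure (borel X) n n) (q : mxmeasure (borel X) n k)
    (r : mxmeasure (borel X) n n)
    (lam0 lam : {finite_measure set (borel X) -> \bar R}) :
  compact [set: X] -> separable X ->
  (0 < n)%N -> (0 < k)%N ->
  psdmx L1 -> pdmx L2 ->
  (forall A : set (borel X), measurable A -> symmx (mxval G A)) ->
  Xtv G q r `<< lam0 -> (Jint G q r L1 L2 lam0 < +oo)%E ->
  Xtv G q r `<< lam ->
  forall E : set (borel X), measurable E ->
  (mxtv q E <= (Num.sqrt (\tr (mxval G E)) * fnorm L1)%:E
     * L2norm G lam E (fun x =>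
         pinverse (mxdensity G lam x) *m mxdensity q lam x *m pinverse L1))%E
  /\
  (mxtv r E <= (Num.sqrt (\tr (mxval G E)) * fnorm L2)%:E
     * L2norm G lam E (fun x =>
         pinverse (mxdensity G lam x) *m mxdensity r lam x *m invmx L2))%E.
Proof.
move=> _ _ _ _ L10 L20 _ Xlam0 Joo Xlam E mE.
have [Glam qlam rlam] := Xtv_dominates Xlam.
have dom := Jdomain_ae Xlam0 Joo Xlam.
(* The right factor cancels by the range condition on [q] and the symmetry of [L1], respectively by
   invertibility of [L2]. *)
split; apply: mxtv_range_le => //; apply: filterS dom => x [G0 qL];
  rewrite ran_sub_row_mx => /andP[qG rG]; split => //.
- exact: ran_sub_symP L10.1 qL.
- by rewrite mulmxKV// pdmx_unit.
Qed.
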